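(* Let $1\le n<m$ and let $A=(a_{ij})_{m\times m}$ be a Cartier-Foata matrix, i.e. $a_{ik}a_{jl}=a_{jl}a_{ik}$ for all $i\neq j$ and all $k,l$. For $n<i,j\le m$ let $$c_{ij}=-\det{}^{-1}(I-A_0)\cdot\det\begin{pmatrix} I-A_0 & -a_{*j}\\ -a_{i*} & -a_{ij}\end{pmatrix},\qquad C=(c_{ij})_{n+1\le i,j\le m}.$$ Then $\det{}^{-1}(I-A_0)\cdot\det(I-A)=\det(I-C)$.
   Context: $\mathcal A$ is the $\mathbb C$-algebra of formal power series in non-commuting variables $a_{ij}$, $1\le i,j\le m$; identities are taken in the quotient of $\mathcal A$ by the closed two-sided ideal generated by the Cartier-Foata relations. $A_0=(a_{ij})_{1\le i,j\le n}$, $a_{i*}=(a_{i1},\dots,a_{in})$, $a_{*j}=(a_{1j},\dots,a_{nj})^T$. For a square matrix $B=(b_{rs})_{N\times N}$ with entries in $\mathcal A$, $\det B=\sum_{\sigma\in S_N}(-1)^{\operatorname{inv}\sigma}b_{\sigma(1)1}\cdots b_{\sigma(N)N}$ (column order of factors). $\det(I-A_0)$ has constant term $1$ and $\det^{-1}(I-A_0)$ is its inverse. $\det(I-C)$ is computed by this same formula with the $c_{ij}$ as entries. *)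

(* Defs.v *)
(* MathComp; boolp supplies extensional equality of series. *)
From HB Require Import structures.
From mathcomp Require Import all_boot all_order all_fingroup all_algebra.
From mathcomp Require Import boolp classical_sets reals.
From mathcomp Require Import complex.

Set Implicit Arguments.
Unset Strict Implicit.
Unset Printing Implicit Defensive.

Import Order.TTheory GRing.Theory Num.Theory.
Local Open Scope ring_scope.
Local Open Scope classical_set_scope.

(* A series in the non-commuting variables x : X is its family of coefficients,
   indexed by the words over X.  The record keeps these apart from the pointwise
   ring structure that functions already carry. *)
Record ncps (K : Type) (X : Type) := NCPS { coef_nc :> seq X -> K }.

Section NCPowerSeries.
Variables (K : fieldType) (X : eqType).
Local Notation S := (ncps K X).
Implicit Types (f g h : S) (w : seq X).

HB.instance Definition _ := [isNew for @coef_nc K X].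
HB.instance Definition _ := gen_eqMixin S.
HB.instance Definition _ := gen_choiceMixin S.

Lemma ncpsP f g : f =1 g -> f = g.
Proof. by case: f g => [f] [g] /= /funext ->. Qed.

Definition nc_zero : S := NCPS (fun=> 0).
Definition nc_opp f : S := NCPS (fun w => - f w).
Definition nc_add f g : S := NCPS (fun w => f w + g w).
Definition nc_one : S := NCPS (fun w => (w == [::])%:R).
Definition nc_mul f g : S :=
  NCPS (fun w => \sum_(k < (size w).+1) f (take k w) * g (drop k w)).

Fact nc_addA : associative nc_add.
Proof. by move=> f g h; apply: ncpsP => w /=; rewrite addrA. Qed.
Fact nc_addC : commutative nc_add.
Proof. by move=> f g; apply: ncpsP => w /=; rewrite addrC. Qed.
Fact nc_add0 : left_id nc_zero nc_add.
Proof. by move=> f; apply: ncpsP => w /=; rewrite add0r. Qed.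
Fact nc_addN : left_inverse nc_zero nc_opp nc_add.
Proof. by move=> f; apply: ncpsP => w /=; rewrite addNr. Qed.

HB.instance Definition _ := GRing.isZmodule.Build S
  nc_addA nc_addC nc_add0 nc_addN.

Definition nc_shift x f : S := NCPS (fun w => f (x :: w)).

Fact nc_mul_nil f g : nc_mul f g [::] = f [::] * g [::].
Proof. by rewrite /= big_ord1. Qed.

Fact nc_mul_cons f g x w :
  nc_mul f g (x :: w) = f [::] * g (x :: w) + nc_mul (nc_shift x f) g w.
Proof. by rewrite /= big_ord_recl. Qed.

Fact nc_mul1 : left_id nc_one nc_mul.
Proof.
move=> f; apply: ncpsP; case=> [|x w]; first by rewrite nc_mul_nil /= mul1r.
rewrite nc_mul_cons /= mul1r big1 ?addr0 // => k _.
by rewrite mul0r.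
Qed.

Fact nc_mul1r : right_id nc_one nc_mul.
Proof.
move=> f; apply: ncpsP => w; elim: w f => [|x w IHw] f.
  by rewrite nc_mul_nil mulr1.
by rewrite nc_mul_cons IHw mulr0 add0r.
Qed.

Fact nc_mulDl : left_distributive nc_mul nc_add.
Proof.
move=> f g h; apply: ncpsP => w /=; rewrite -big_split.
by apply: eq_bigr => k _; rewrite mulrDl.
Qed.

Fact nc_mulDr : right_distributive nc_mul nc_add.
Proof.
move=> f g h; apply: ncpsP => w /=; rewrite -big_split.
by apply: eq_bigr => k _; rewrite mulrDr.
Qed.

Fact nc_mulA : associative nc_mul.
Proof.
move=> f g h; apply: ncpsP => w; elim: w f => [|x w IHw] f.
  by rewrite !nc_mul_nil mulrA.
rewrite !nc_mul_cons IHw nc_mul_nil mulrDr -!mulrA -addrA; congr (_ + _).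
have -> : nc_shift x (nc_mul f g) =
    nc_add (NCPS (fun w => f [::] * g (x :: w))) (nc_mul (nc_shift x f) g).
  by apply: ncpsP => u; exact: nc_mul_cons.
rewrite nc_mulDl [LHS]/=; congr (_ + _).
by rewrite mulr_sumr; apply: eq_bigr => k _; rewrite mulrA.
Qed.

Fact nc_one_neq0 : nc_one != 0 :> S.
Proof.
by apply/eqP => /(congr1 (fun f : S => f [::])) /= /eqP; rewrite oner_eq0.
Qed.

HB.instance Definition _ := GRing.Zmodule_isNzRing.Build S
  nc_mulA nc_mul1 nc_mul1r nc_mulDl nc_mulDr nc_one_neq0.

Lemma coef_nc0 w : (0 : S) w = 0. Proof. by []. Qed.
Lemma coef_nc1 w : (1 : S) w = (w == [::])%:R. Proof. by []. Qed.
Lemma coef_ncN f w : (- f) w = - f w. Proof. by []. Qed.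
Lemma coef_ncD f g w : (f + g) w = f w + g w. Proof. by []. Qed.
Lemma coef_ncB f g w : (f - g) w = f w - g w. Proof. by []. Qed.
Lemma coef_ncM f g w :
  (f * g) w = \sum_(k < (size w).+1) f (take k w) * g (drop k w).
Proof. by []. Qed.

Lemma coef_nc_sum (I : Type) (r : seq I) (P : pred I) (F : I -> S) w :
  (\sum_(i <- r | P i) F i) w = \sum_(i <- r | P i) F i w.
Proof. exact: (big_morph (fun f : S => f w)). Qed.

Definition nc_const f : K := f [::].

Fact nc_const_additive : zmod_morphism nc_const. Proof. by []. Qed.
Fact nc_const_monoid : monoid_morphism nc_const.
Proof. by split=> // f g; exact: nc_mul_nil. Qed.
HB.instance Definition _ := GRing.isZmodMorphism.Build S K nc_const
  nc_const_additive.
HB.instance Definition _ := GRing.isMonoidMorphism.Build S K nc_const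
  nc_const_monoid.

Definition nc_scalar (a : K) : S := NCPS (fun w => if w is [::] then a else 0).

Lemma coef_nc_scalarM a f w : (nc_scalar a * f) w = a * f w.
Proof.
rewrite coef_ncM big_ord_recl take0 drop0 /= big1 ?addr0 // => k _.
by case: w k => [|x w] [k ltk] //=; rewrite mul0r.
Qed.

Lemma nc_scalarM a b : nc_scalar a * nc_scalar b = nc_scalar (a * b).
Proof.
by apply: ncpsP => w; rewrite coef_nc_scalarM; case: w => //= *; rewrite mulr0.
Qed.

Lemma nc_scalar1 : nc_scalar 1 = 1.
Proof. by apply: ncpsP; case. Qed.

Lemma coef_ncX_small f k w :
  f [::] = 0 -> (size w < k)%N -> (f ^+ k) w = 0.
Proof.
move=> f0; elim: k w => // k IHk w ltwk; rewrite exprS coef_ncM big1 // => i _.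
case: (posnP i) => [->|i_gt0]; first by rewrite take0 f0 mul0r.
rewrite IHk ?mulr0 // size_drop.
have lt_i := ltn_ord i; rewrite ltnS in lt_i.
by rewrite -ltnS (leq_trans _ ltwk) // ltnS ltn_subrL i_gt0 (leq_trans i_gt0).
Qed.

(* the geometric series \sum_k f ^+ k, meaningful when f has no constant term *)
Definition nc_geom f : S := NCPS (fun w => \sum_(k < (size w).+1) (f ^+ k) w).

Lemma coef_nc_geom f w N : f [::] = 0 -> (size w < N)%N ->
  nc_geom f w = (\sum_(k < N) f ^+ k) w.
Proof.
move=> f0 ltwN; rewrite coef_nc_sum /=.
rewrite (big_ord_widen_cond N predT (fun k => (f ^+ k) w)) //.
rewrite [RHS](bigID (fun k : 'I_N => (k < (size w).+1)%N)) /=.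
rewrite [X in _ = _ + X]big1 ?addr0 // => k; rewrite ltnS -ltnNge => ltk.
exact: coef_ncX_small.
Qed.

Lemma nc_geomVl f : f [::] = 0 -> nc_geom f * (1 - f) = 1.
Proof.
move=> f0; apply: ncpsP => w.
have -> : (nc_geom f * (1 - f)) w =
    ((\sum_(k < (size w).+1) f ^+ k) * (1 - f)) w.
  rewrite !coef_ncM; apply: eq_bigr => i _; congr (_ * _).
  by apply: coef_nc_geom => //; rewrite ltnS size_take_min geq_minr.
suff -> : (\sum_(k < (size w).+1) f ^+ k) * (1 - f) = 1 - f ^+ (size w).+1.
  by rewrite coef_ncB coef_ncX_small ?subr0.
elim: (size w).+1 => [|N IHN]; first by rewrite big_ord0 mul0r expr0 subrr.
by rewrite big_ord_recr /= mulrDl IHN mulrBr mulr1 -exprSr addrA addrNK.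
Qed.

Lemma nc_geomVr f : f [::] = 0 -> (1 - f) * nc_geom f = 1.
Proof.
move=> f0; apply: ncpsP => w.
have -> : ((1 - f) * nc_geom f) w =
    ((1 - f) * (\sum_(k < (size w).+1) f ^+ k)) w.
  rewrite !coef_ncM; apply: eq_bigr => i _; congr (_ * _).
  by apply: coef_nc_geom => //; rewrite ltnS size_drop leq_subr.
suff -> : (1 - f) * (\sum_(k < (size w).+1) f ^+ k) = 1 - f ^+ (size w).+1.
  by rewrite coef_ncB coef_ncX_small ?subr0.
elim: (size w).+1 => [|N IHN]; first by rewrite big_ord0 mulr0 expr0 subrr.
by rewrite big_ord_recr /= mulrDr IHN mulrBl mul1r -exprS addrA addrNK.
Qed.

Definition nc_unit : pred S := fun f => nc_const f != 0.

Definition nc_inv f : S :=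
  let c := nc_scalar (nc_const f)^-1 in
  if nc_unit f then nc_geom (1 - c * f) * c else f.

Let nc_inv_const0 f : nc_unit f ->
  (1 - nc_scalar (nc_const f)^-1 * f) [::] = 0.
Proof.
move=> uf; rewrite coef_ncB coef_nc1 coef_nc_scalarM /= -/(nc_const f).
by rewrite mulVf // subrr.
Qed.

Fact nc_mulV : {in nc_unit, left_inverse 1 nc_inv *%R}.
Proof.
move=> f uf; rewrite /nc_inv ifT // -mulrA.
by have := nc_geomVl (nc_inv_const0 uf); rewrite subKr.
Qed.

Fact nc_divV : {in nc_unit, right_inverse 1 nc_inv *%R}.
Proof.
move=> f uf; rewrite /nc_inv ifT //.
have := nc_geomVr (nc_inv_const0 uf); rewrite subKr.
set u := 1 - _; set c := nc_scalar _ => cfg.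
have cVc : nc_scalar (nc_const f) * c = 1.
  by rewrite nc_scalarM divff // nc_scalar1.
have -> : f * (nc_geom u * c) = nc_scalar (nc_const f) * (c * f * nc_geom u) * c.
  by rewrite !mulrA cVc mul1r.
by rewrite cfg mulr1.
Qed.

Fact nc_unitP f g : g * f = 1 /\ f * g = 1 -> nc_unit f.
Proof.
case=> gf1 _; apply/eqP => f0; have /eqP := oner_neq0 K; case.
by rewrite -[RHS](mulr0 (nc_const g)) -f0 -rmorphM gf1 rmorph1.
Qed.

Fact nc_inv_out : {in [predC nc_unit], nc_inv =1 id}.
Proof. by move=> f nuf; rewrite /nc_inv ifN. Qed.

HB.instance Definition _ := GRing.NzRing_hasMulInverse.Build S
  nc_mulV nc_divV nc_unitP nc_inv_out.

Lemma nc_unitE f : (f \is a GRing.unit) = (nc_const f != 0).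
Proof. by []. Qed.

Definition nc_var (x : X) : S := NCPS (fun w => (w == [:: x])%:R).

(* Two-sided ideals, and closedness for the topology in which the series that
   agree with f on all words of length < d form a basis of neighbourhoods
   of f. *)
Definition nc_ideal (J : set S) : Prop :=
  [/\ J 0, forall f g, J f -> J g -> J (f + g)
    & forall u f v, J f -> J (u * f * v)].

Definition nc_closed (J : set S) : Prop :=
  forall f, (forall d, exists2 g, J g &
               forall w, (size w < d)%N -> g w = f w) -> J f.

Definition nc_closed_ideal (G : set S) : set S :=
  smallest [set J | nc_ideal J /\ nc_closed J] G.

End NCPowerSeries.

Section ColumnDeterminant.

Definition perm_inv N (s : 'S_N) : nat :=
  #|[pred p : 'I_N * 'I_N | (p.1 < p.2)%N && (s p.2 < s p.1)%N]|.

Lemma sign_perm_inv (R : pzRingType) N (s : 'S_N) :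
  (-1) ^+ perm_inv s = (-1) ^+ s :> R.
Proof.
suff e : (-1) ^+ perm_inv s = (-1) ^+ s :> int.
  rewrite -signr_odd -[RHS]signr_odd; congr (_ ^+ _).
  move: e; rewrite -signr_odd -[RHS]signr_odd.
  by case: (odd _); case: (odd _).
pose a : 'rV[int]_N := \row_j (j : nat)%:Z.
have e : \det (Vandermonde N (col_perm s a)) = (-1) ^+ s * \det (Vandermonde N a).
  have -> : Vandermonde N (col_perm s a) = col_perm s (Vandermonde N a).
    by apply/matrixP=> i j; rewrite !mxE.
  by rewrite col_permE det_mulmx det_perm odd_permV mulrC.
have sgV (t : 'S_N) : Num.sg (\det (Vandermonde N (col_perm t a))) =
    (-1) ^+ perm_inv t.
  rewrite det_Vandermonde pair_big_dep /= (big_morph _ (@sgrM _) (@sgr1 _)).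
  rewrite /perm_inv -sum1_card.
  rewrite (big_morph (fun k => (-1) ^+ k : int) (exprD _) (expr0 _)).
  rewrite [RHS]big_mkcondr /=.
  apply: eq_bigr => -[i j] /= ltij; rewrite !mxE.
  case: ltngtP => [lt|lt|/val_inj/perm_inj eij].
  - by rewrite ltr0_sg // subr_lt0 ltz_nat.
  - by rewrite gtr0_sg // subr_gt0 ltz_nat.
  - by move: ltij; rewrite eij ltnn.
have inv1 : perm_inv (1 : 'S_N) = 0%N.
  apply: eq_card0 => p; rewrite !inE !perm1; apply/negP => /andP[lt1 lt2].
  by have := ltn_trans lt1 lt2; rewrite ltnn.
have := congr1 Num.sg e; rewrite sgrM sgV sgrX sgrN1 => ->.
have := sgV 1%g; rewrite inv1 expr0.
have -> : col_perm 1%g a = a by apply/matrixP => i j; rewrite !mxE perm1.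
by move=> ->; rewrite mulr1.
Qed.

(* The library's \det multiplies the entries of each term in row order, which
   matters over a non-commutative ring. *)
Definition cdet (R : pzRingType) N (B : 'M[R]_N) : R :=
  \sum_(s : 'S_N) (-1) ^+ perm_inv s * \prod_(j < N) B (s j) j.

Lemma cdetE (R : pzRingType) N (B : 'M[R]_N) : cdet B = \det B^T.
Proof.
apply: eq_bigr => s _; rewrite sign_perm_inv; congr (_ * _).
by apply: eq_bigr => j _; rewrite mxE.
Qed.

End ColumnDeterminant.

Section CartierFoata.
Variables (K : fieldType) (m : nat).
Local Notation A := (ncps K ('I_m * 'I_m)%type).

Definition cf_gen : 'M[A]_m := \matrix_(i, j) nc_var K (i, j).

Definition cf_relations : set A :=
  [set f | exists i j k l : 'I_m, i != j /\
     f = cf_gen i k * cf_gen j l - cf_gen j l * cf_gen i k].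

(* equality in the quotient of the series algebra by the closed two-sided ideal
   generated by the Cartier-Foata relations *)
Definition cf_eq (f g : A) : Prop := nc_closed_ideal cf_relations (f - g).

End CartierFoata.

Section Blocks.
Variables (K : fieldType) (m n : nat) (le_nm : (n <= m)%N).
Local Notation A := (ncps K ('I_m * 'I_m)%type).

(* lo_idx selects the first n indices, hi_idx the remaining m - n, in order *)
Definition lo_idx (i : 'I_n) : 'I_m := widen_ord le_nm i.
Definition hi_idx (i : 'I_(m - n)) : 'I_m :=
  cast_ord (subnKC le_nm) (rshift n i).

Definition cf_gen0 : 'M[A]_n := mxsub lo_idx lo_idx (cf_gen K m).

Definition cf_bordered (i j : 'I_m) : 'M[A]_(n + 1) :=
  block_mx (1%:M - cf_gen0)
           (- \col_k cf_gen K m (lo_idx k) j)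
           (- \row_k cf_gen K m i (lo_idx k))
           (- (cf_gen K m i j)%:M).

Definition cf_C : 'M[A]_(m - n) :=
  \matrix_(i, j) (- (cdet (1%:M - cf_gen0))^-1
                    * cdet (cf_bordered (hi_idx i) (hi_idx j))).

Lemma cdet_gen0_unit : cdet (1%:M - cf_gen0) \is a GRing.unit.
Proof.
rewrite nc_unitE cdetE -det_map_mx.
suff -> : map_mx (@nc_const K _) (1%:M - cf_gen0)^T = 1%:M.
  by rewrite det1 oner_neq0.
apply/matrixP => i j; rewrite !mxE rmorphB /= eq_sym.
by rewrite /nc_const /= subr0; case: eqP.
Qed.

End Blocks.

(* Main.v *)
(* Let A be a matrix whose entries in different rows commute.  The column
   determinant vanishes when two columns coincide up to a right factor on the
   later one, provided all other columns before it come from A.  Restoring the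
   columns of A T to those of A from left to right, it follows that
   det (A T) = det A for every upper unitriangular T with arbitrary entries.
   For I - A = [B, U; V, D] and B X = U, the choice T = [1, -X; 0, 1] gives
   [B, 0; V, D - V X], hence the Schur formula
   det (I - A) = det B * det (D - V X).  The same formula for the bordered
   matrices, whose Schur complement is 1 x 1, identifies the entries of I - C
   with those of D - V X.  The right inverse of B = I - A_0 that provides X is
   the series of path words, and the commutations hold in the quotient ring. *)
Require Import Defs.
From HB Require Import structures.
From mathcomp Require Import all_boot all_order all_fingroup all_algebra.
From mathcomp Require Import generic_quotient.
From mathcomp Require Import boolp classical_sets reals.
From mathcomp Require Import complex.
Import GRing.Theory.
Local Open Scope ring_scope.

Set Implicit Arguments.
Unset Strict Implicit.
Unset Printing Implicit Defensive.

(** * Splitting ordered products at an index *)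

Section OrderedProducts.
Variable R : pzRingType.

(** The factors need not commute, so the one at [p] has to stay in place; the product is moved to an
    interval of [nat], which can be cut there. *)
Lemma prod_ord_split n (P : pred 'I_n) (F : 'I_n -> R) (p : 'I_n) : P p ->
  \prod_(i | P i) F i =
  (\prod_(i | P i && (i < p)%N) F i) * (F p * \prod_(i | P i && (p < i)%N) F i).
Proof.
(* The default 1 makes indices outside [P] or beyond [n] harmless. *)
move=> Pp; pose G k :=
  oapp (fun i => if P i then F i else 1) 1 (insub k : option 'I_n).
have GE (i : 'I_n) : (if P i then F i else 1) = G i by rewrite /G valK.
have bigG (Q : pred nat) :
    \prod_(i | P i && Q i) F i = \prod_(0 <= k < n | Q k) G k.
  rewrite big_mkord big_mkcondl.
  by apply: eq_bigr => i _; rewrite GE.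
have -> : \prod_(i | P i) F i = \prod_(0 <= k < n) G k.
  rewrite -(bigG predT); apply: eq_bigl => i.
  by rewrite andbT.
rewrite (bigG (fun k => k < p)%N) (bigG (fun k => p < k)%N).
rewrite (big_cat_nat (n := p)) ?(ltnW (ltn_ord p)) //=.
rewrite (big_ltn (m := p)) // -GE Pp; congr (_ * (_ * _)).
  by rewrite (big_nat_widen _ _ n) ?(ltnW (ltn_ord p)).
by rewrite (big_nat_widenl _ 0).
Qed.

End OrderedProducts.

(** * Column operations on the column determinant *)

Section ColumnOperations.
Variable R : pzRingType.

Definition row_commuting m n (A : 'M[R]_(m, n)) :=
  forall i j k l, i != j -> A i k * A j l = A j l * A i k.

Definition set_col n (A : 'M[R]_n) (p : 'I_n) (u : 'I_n -> R) : 'M[R]_n :=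
  \matrix_(i, j) if j == p then u i else A i j.

Lemma cdet_sum n (A : 'M[R]_n) :
  cdet A = \sum_(s : 'S_n) (-1) ^+ s * \prod_j A (s j) j.
Proof. by apply: eq_bigr => s _; rewrite sign_perm_inv. Qed.

Lemma cdet_set_col n (A : 'M[R]_n) p u :
  cdet (set_col A p u) = \sum_(s : 'S_n) (-1) ^+ s *
    ((\prod_(j < n | (j < p)%N) A (s j) j) *
      (u (s p) * \prod_(j < n | (p < j)%N) A (s j) j)).
Proof.
rewrite cdet_sum; apply: eq_bigr => s _; congr (_ * _).
rewrite (prod_ord_split _ (p := p)) //= mxE eqxx; congr (_ * (_ * _)).
  by apply: eq_bigr => j ltjp; rewrite mxE -val_eqE ltn_eqF.
by apply: eq_bigr => j ltpj; rewrite mxE -val_eqE gtn_eqF.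
Qed.

Lemma cdet_set_col_sum n (A : 'M[R]_n) p (I : Type) (r : seq I) (P : pred I)
    (u : I -> 'I_n -> R) :
  cdet (set_col A p (fun i => \sum_(l <- r | P l) u l i)) =
  \sum_(l <- r | P l) cdet (set_col A p (u l)).
Proof.
rewrite cdet_set_col; under [RHS]eq_bigr do rewrite cdet_set_col.
rewrite exchange_big; apply: eq_bigr => s _ /=.
by rewrite mulr_suml !mulr_sumr.
Qed.

(** The terms of [s] and [t * s] cancel: their signs are opposite, and their products differ only by
    exchanging the entries of rows [s l] and [s p]. The exchange takes place among columns before
    [p], so [x] and the later columns never have to be crossed. *)
Lemma cdet_set_col_eq n (A : 'M[R]_n) (l p : 'I_n) x :
    (l < p)%N ->
    (forall i i' (j j' : 'I_n), (j < p)%N -> (j' < p)%N -> i != i' ->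
       A i j * A i' j' = A i' j' * A i j) ->
  cdet (set_col A p (fun i => A i l * x)) = 0.
Proof.
move=> ltlp commA; rewrite cdet_set_col.
pose t := tperm l p.
have tid j : j != l -> j != p -> t j = j.
  by move=> ? ?; rewrite tpermD // eq_sym.
have neq_lp : l != p by rewrite -val_eqE ltn_eqF.
(* The even permutations are rewritten as [t * s] with [s] odd, so that both sums run over odd
   [s]. *)
rewrite (bigID (@odd_perm _)) /= addrC (reindex_inj (mulgI t)) /=.
rewrite (eq_bigl (@odd_perm _)); last first.
  by move=> s; rewrite odd_mul_tperm neq_lp addTb negbK.
rewrite -big_split big1 //= => s odds.
rewrite odd_mul_tperm neq_lp odds expr0 expr1 mul1r mulN1r.
apply/eqP; rewrite subr_eq0; apply/eqP.
rewrite !permM tpermR.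
have split_l (s' : 'S_n) : \prod_(j < n | (j < p)%N) A (s' j) j =
    (\prod_(j < n | (j < p)%N && (j < l)%N) A (s' j) j) *
      (A (s' l) l * \prod_(j < n | (j < p)%N && (l < j)%N) A (s' j) j).
  exact: prod_ord_split.
rewrite !split_l.
have eqL : \prod_(j < n | (j < p)%N && (j < l)%N) A ((t * s)%g j) j =
    \prod_(j < n | (j < p)%N && (j < l)%N) A (s j) j.
  apply: eq_bigr => j /andP[ltjp ltjl].
  by rewrite permM tid // -val_eqE ltn_eqF.
have eqM : \prod_(j < n | (j < p)%N && (l < j)%N) A ((t * s)%g j) j =
    \prod_(j < n | (j < p)%N && (l < j)%N) A (s j) j.
  apply: eq_bigr => j /andP[ltjp ltlj].
  by rewrite permM tid // -val_eqE ?(ltn_eqF ltjp) ?(gtn_eqF ltlj).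
have eqR : \prod_(j < n | (p < j)%N) A ((t * s)%g j) j =
    \prod_(j < n | (p < j)%N) A (s j) j.
  apply: eq_bigr => j ltpj.
  by rewrite permM tid // -val_eqE ?(gtn_eqF ltpj)
    ?(gtn_eqF (ltn_trans ltlp ltpj)).
rewrite eqL eqM eqR permM tpermL.
set L := \prod_(j < n | _) _; set M := \prod_(j < n | _) _.
set T := \prod_(j < n | _) _.
(* The factors of [M] lie in rows [s j] with [l < j < p], hence in rows other than [s l] and
   [s p]. *)
have commM k : k \in [:: l; p] -> M * A (s k) l = A (s k) l * M.
  move=> kP; apply/esym; apply: commr_prod => j /andP[ltjp ltlj].
  apply: commA => //; rewrite (inj_eq perm_inj).
  by move: kP; rewrite !inE => /orP[] /eqP->; rewrite -val_eqE
    ?(gtn_eqF ltjp) ?(ltn_eqF ltlj).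
rewrite -!mulrA; congr (_ * _); rewrite !mulrA; congr (_ * _ * _).
rewrite -!mulrA !commM ?inE ?eqxx ?orbT // !mulrA; congr (_ * _).
by apply: commA => //; rewrite (inj_eq perm_inj) eq_sym.
Qed.

(** The order from left to right matters: columns of [A *m T] need not satisfy the commutation
    relations, but when column [p] is restored all columns before it are already those of [A]. *)
Lemma cdet_mul_unitriangular n (A T : 'M[R]_n) :
    row_commuting A -> (forall i, T i i = 1) ->
    (forall i j : 'I_n, (j < i)%N -> T i j = 0) ->
  cdet (A *m T) = cdet A.
Proof.
move=> commA T1 T0.
pose F k : 'M[R]_n := \matrix_(i, j) if (j < k)%N then A i j else (A *m T) i j.
have F0 : F 0 = A *m T by apply/matrixP => i j; rewrite mxE.
have Fn : F n = A by apply/matrixP => i j; rewrite mxE ltn_ord.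
rewrite -F0 -[in RHS]Fn.
suff: forall k, (k <= n)%N -> cdet (F 0) = cdet (F k) by exact.
elim=> // k IHk ltkn; rewrite IHk 1?ltnW // => {IHk}.
pose p := Ordinal ltkn.
have -> : F k = set_col (F k.+1) p (fun i => \sum_l A i l * T l p).
  apply/matrixP => i j; rewrite !mxE; case: eqP => [->|/eqP neqjp].
    by rewrite ltnn.
  by rewrite ltnS [in RHS]leq_eqVlt -[_ == k]/(j == p) (negPf neqjp).
rewrite cdet_set_col_sum (bigD1 p) //= [X in _ + X]big1 ?addr0.
  congr cdet; apply/matrixP => i j; rewrite !mxE T1 mulr1.
  by case: eqP => // ->; rewrite ltnS leqnn.
move=> l neqlp.
have FA i (j : 'I_n) : (j <= k)%N -> F k.+1 i j = A i j.
  by move=> lejk; rewrite mxE ltnS lejk.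
case: (ltngtP l p) => [ltlp|ltpl|/val_inj eqlp].
- rewrite (_ : set_col _ _ _ =
      set_col (F k.+1) p (fun i => F k.+1 i l * T l p)).
    apply: cdet_set_col_eq => // i i' j j' ltjp ltj'p neqii'.
    by rewrite !FA 1?ltnW // commA.
  apply/matrixP => i j; rewrite [LHS]mxE [RHS]mxE.
  by rewrite (FA i l) ?(ltnW (ltlp : (l < k)%N)).
(* A zero column is written as an empty sum, so that linearity in the column gives 0. *)
- rewrite (_ : set_col _ _ _ =
      set_col (F k.+1) p (fun=> \sum_(i <- @nil nat) 0)).
    by rewrite cdet_set_col_sum big_nil.
  by apply/matrixP => i j; rewrite !mxE T0 // mulr0 big_nil.
- by rewrite eqlp eqxx in neqlp.
Qed.

End ColumnOperations.

(** * Block triangular determinants and the Schur complement *)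

Section BlockDeterminant.
Variable R : pzRingType.

(** The last column supplies the rightmost factor of every term, so expanding along it preserves the
    order of factors. A permutation corresponds to the image [i] of [ord_max] together with a
    permutation of the remaining indices. *)
Lemma cdet_expand_last_col n (A : 'M[R]_n.+1) :
  cdet A = \sum_(i < n.+1) (-1) ^+ (i + n) *
             (cdet (row' i (col' ord_max A)) * A i ord_max).
Proof.
rewrite cdet_sum.
pose h (q : 'I_n.+1 * 'S_n) := lift_perm ord_max q.1 q.2.
have inj_h : injective h.
  move=> [i s] [i' s'] eqh.
  have eqi : i = i'.
    by rewrite -(lift_perm_id ord_max i s) -[LHS]/(h (i, s) _) eqh lift_perm_id.
  congr (_, _) => //; apply/permP => k.
  apply: (@lift_inj _ i); rewrite -(lift_perm_lift ord_max i s).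
  by rewrite -[lift_perm _ _ _]/(h (i, s)) eqh lift_perm_lift eqi.
have bij_h : bijective h.
  by apply: inj_card_bij => //; rewrite card_prod !card_Sn card_ord factS.
rewrite (reindex h) /=; last exact: onW_bij.
rewrite -(pair_bigA _ (fun i s => (-1) ^+ (lift_perm ord_max i s) *
  \prod_j A (lift_perm ord_max i s j) j)) /=.
apply: eq_bigr => i _; rewrite cdet_sum mulr_suml mulr_sumr.
apply: eq_bigr => s _.
rewrite big_ord_recr /= lift_perm_id !mulrA; congr (_ * _ * _).
  by rewrite odd_lift_perm !signr_addb !signr_odd /= -exprD addnC.
apply: eq_bigr => j _; rewrite !mxE.
have -> : widen_ord (leqnSn n) j = lift ord_max j.
  by apply/val_inj; rewrite /= /bump leqNgt ltn_ord.
by rewrite lift_perm_lift.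
Qed.

(* Indexing by nat avoids casts between [(n1 + n2.+1).-1] and [n1 + n2]. *)
Definition cdet_nat n (f : nat -> nat -> R) :=
  cdet (\matrix_(i < n, j < n) f i j).

Lemma eq_cdet_nat n f g :
  (forall i j, (i < n)%N -> (j < n)%N -> f i j = g i j) ->
  cdet_nat n f = cdet_nat n g.
Proof. by move=> efg; congr cdet; apply/matrixP => i j; rewrite !mxE efg. Qed.

Lemma cdet_nat_expand n f : cdet_nat n.+1 f =
  \sum_(i < n.+1) (-1) ^+ (i + n) *
    (cdet_nat n (fun k j => f (bump i k) j) * f i n).
Proof.
rewrite /cdet_nat cdet_expand_last_col; apply: eq_bigr => i _; rewrite mxE.
congr (_ * (cdet _ * _)); apply/matrixP => k j; rewrite !mxE.
by rewrite lift_max.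
Qed.

(** By induction on [n2], expanding along the last column: its top [n1] entries vanish, and deleting
    a lower row keeps the block shape. *)
Lemma cdet_nat_lblock n1 n2 f :
    (forall i j, (i < n1)%N -> (n1 <= j)%N -> f i j = 0) ->
  cdet_nat (n1 + n2) f =
    cdet_nat n1 f * cdet_nat n2 (fun i j => f (n1 + i)%N (n1 + j)%N).
Proof.
elim: n2 f => [|n2 IHn] f f0.
  rewrite addn0 [X in _ * X](_ : _ = 1) ?mulr1 //.
  rewrite /cdet_nat cdet_sum (big_pred1 1%g) => [|s].
    by rewrite odd_perm1 mul1r big_ord0.
  by apply/esym/eqP/permP => -[].
rewrite addnS !cdet_nat_expand -addnS big_split_ord /=.
rewrite big1 ?add0r => [|i _]; last first.
  by rewrite f0 ?leq_addr ?ltn_ord // !mulr0.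
rewrite mulr_sumr; apply: eq_bigr => i _.
rewrite IHn => [|k j ltk lej]; last first.
  by rewrite /bump leqNgt (leq_trans ltk) ?leq_addr // f0.
(* The offset [n1] enters both the row and the column index, so it does not affect the sign. *)
rewrite (_ : (n1 + i + (n1 + n2) = n1.*2 + (i + n2))%N); last first.
  by rewrite addnACA addnn.
rewrite exprD -signr_odd odd_double mul1r !mulrA; congr (_ * _).
rewrite [in RHS]commr_sign; congr (_ * _ * _).
  apply: eq_cdet_nat => k j ltk _.
  by rewrite /bump leqNgt (leq_trans ltk) ?leq_addr.
by apply: eq_cdet_nat => k j _ _; rewrite /bump leq_add2l addnCA.
Qed.

Lemma cdet_lblock n1 n2 (B : 'M[R]_n1) (V : 'M[R]_(n2, n1)) (S : 'M[R]_n2) :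
  cdet (block_mx B 0 V S) = cdet B * cdet S.
Proof.
set M := block_mx _ _ _ _.
pose f i j := oapp (fun i' => oapp (fun j' => M i' j') 0 (insub j)) 0 (insub i).
have fE (i j : 'I_(n1 + n2)) : f i j = M i j by rewrite /f !valK.
have -> : cdet M = cdet_nat (n1 + n2) f.
  by congr cdet; apply/matrixP => i j; rewrite mxE fE.
rewrite cdet_nat_lblock; last first.
  move=> i j lti lej; rewrite /f.
  case: (@insubP _ _ _ j) => [j' _ vj|_] /=; last by case: insub.
  case: insubP => //= i' _ vi.
  rewrite -(splitK i') -(splitK j').
  case: (splitP i') => [i1 _|i1 ei]; last
    by move: lti; rewrite -vi /= ei ltnNge leq_addr.
  case: (splitP j') => [j1 ej|j1 _]; first
    by move: lej; rewrite -vj /= ej leqNgt ltn_ord.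
  by rewrite /M block_mxEur mxE.
congr (_ * _); congr cdet; apply/matrixP => i j; rewrite mxE.
  by rewrite (fE (lshift n2 i) (lshift n2 j)) /M block_mxEul.
by rewrite (fE (rshift n1 i) (rshift n1 j)) /M block_mxEdr.
Qed.

(** [X] plays the role of the inverse of [B] times [U]; a right inverse of [B] is enough to produce
    it. *)
Lemma cdet_schur n1 n2 (B : 'M[R]_n1) (U : 'M[R]_(n1, n2)) (V : 'M[R]_(n2, n1))
    (D : 'M[R]_n2) (X : 'M[R]_(n1, n2)) :
    row_commuting (block_mx B U V D) -> B *m X = U ->
  cdet (block_mx B U V D) = cdet B * cdet (D - V *m X).
Proof.
move=> commM BX.
rewrite -(cdet_mul_unitriangular (T := block_mx 1%:M (- X) 0 1%:M)) //.
- rewrite mulmx_block !mulmx0 !mulmx1 !addr0 !mulmxN BX addNr.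
  by rewrite cdet_lblock addrC.
- move=> i; rewrite -(splitK i); case: split => k /=.
    by rewrite block_mxEul mxE eqxx.
  by rewrite block_mxEdr mxE eqxx.
move=> i j; rewrite -(splitK i) -(splitK j).
case: (split i) => k; case: (split j) => l /= ltij.
- by rewrite block_mxEul mxE -val_eqE gtn_eqF.
- have := leq_ltn_trans (leq_addr l n1) (ltn_trans ltij (ltn_ord k)).
  by rewrite ltnn.
- by rewrite block_mxEdl mxE.
- by rewrite block_mxEdr mxE -val_eqE gtn_eqF // -(ltn_add2l n1).
Qed.

End BlockDeterminant.

(** * The quotient ring by a closed two-sided ideal *)

Section ClosedIdealQuotient.
Import ring_quotient.Quotient.
Local Open Scope quotient_scope.
Variables (K : fieldType) (X : eqType) (G : set (ncps K X)).
Local Notation S := (ncps K X).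

Lemma nc_closed_ideal_gen f : G f -> nc_closed_ideal G f.
Proof. by move=> Gf J [_]; apply. Qed.

Lemma nc_closed_ideal_ideal : nc_ideal (nc_closed_ideal G).
Proof.
split=> [J [[[J0 _ _] _] _] // | f g If Ig J CJ | u f v If J CJ].
  by case: (CJ) => -[[_ JD _] _] _; apply: JD; [exact: If | exact: Ig].
by case: (CJ) => -[[_ _ JM] _] _; apply: JM; exact: If.
Qed.

Definition in_closed_ideal : pred S := fun f => `[< nc_closed_ideal G f >].

Lemma in_closed_idealP f :
  reflect (nc_closed_ideal G f) (f \in in_closed_ideal).
Proof. exact: asboolP. Qed.

Fact in_closed_ideal_zmod : zmod_closed in_closed_ideal.
Proof.
have [I0 ID IM] := nc_closed_ideal_ideal.
split=> [|f g /in_closed_idealP If /in_closed_idealP Ig].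
  by apply/in_closed_idealP.
apply/in_closed_idealP; have := ID _ _ If (IM (-1) g 1 Ig).
by rewrite mulN1r mulr1.
Qed.

HB.instance Definition _ := GRing.isZmodClosed.Build S in_closed_ideal
  in_closed_ideal_zmod.

Lemma in_closed_idealM u f v :
  f \in in_closed_ideal -> u * f * v \in in_closed_ideal.
Proof.
have [_ _ IM] := nc_closed_ideal_ideal.
by move=> /in_closed_idealP If; apply/in_closed_idealP; exact: IM.
Qed.

(** This is first the quotient of additive groups; the product is added below, using that the ideal
    is two-sided. *)
Definition ncq := quot (GRing.ZmodClosed.clone S in_closed_ideal _).
HB.instance Definition _ := GRing.Zmodule.on ncq.
HB.instance Definition _ := @EqQuotient.on ncq.

Local Notation pi := (\pi_ncq : S -> ncq).

Lemma pi_ncqP f g : reflect (pi f = pi g) (f - g \in in_closed_ideal).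
Proof. by rewrite idealrBE; exact: eqP. Qed.

Definition ncq_mul := lift_op2 ncq *%R.

(** With representatives [f'] and [g'], one has [f * g - f' * g' = (f - f') * g + f' * (g - g')],
    and both summands lie in the ideal. *)
Lemma pi_ncqM f g : pi (f * g) = ncq_mul (pi f) (pi g).
Proof.
unlock ncq_mul; apply/pi_ncqP.
have If : f - repr (pi f) \in in_closed_ideal by apply/pi_ncqP; rewrite reprK.
have Ig : g - repr (pi g) \in in_closed_ideal by apply/pi_ncqP; rewrite reprK.
rewrite -[f * g](subrK (repr (pi f) * g)) -addrA -mulrBl -mulrBr rpredD //.
  by rewrite -[_ * g]mul1r mulrA in_closed_idealM.
by rewrite -[_ * (g - _)]mulr1 in_closed_idealM.
Qed.

Fact ncq_mulA : associative ncq_mul.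
Proof.
by move=> x y z; rewrite -[x]reprK -[y]reprK -[z]reprK -!pi_ncqM mulrA.
Qed.

Fact ncq_mul1 : left_id (pi 1) ncq_mul.
Proof. by move=> x; rewrite -[x]reprK -pi_ncqM mul1r. Qed.

Fact ncq_mul1r : right_id (pi 1) ncq_mul.
Proof. by move=> x; rewrite -[x]reprK -pi_ncqM mulr1. Qed.

Fact ncq_mulDl : left_distributive ncq_mul +%R.
Proof.
move=> x y z; rewrite -[x]reprK -[y]reprK -[z]reprK.
by rewrite -raddfD -!pi_ncqM -raddfD mulrDl.
Qed.

Fact ncq_mulDr : right_distributive ncq_mul +%R.
Proof.
move=> x y z; rewrite -[x]reprK -[y]reprK -[z]reprK.
by rewrite -raddfD -!pi_ncqM -raddfD mulrDr.
Qed.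

(** For arbitrary [G] the ideal may be the whole ring, so the structure chosen is one that admits
    [1 = 0]. *)
HB.instance Definition _ := GRing.Zmodule_isPzRing.Build ncq
  ncq_mulA ncq_mul1 ncq_mul1r ncq_mulDl ncq_mulDr.

Definition ncq_pi (f : S) : ncq := pi f.

Fact ncq_pi_additive : zmod_morphism ncq_pi.
Proof. exact: raddfB. Qed.
Fact ncq_pi_monoid : monoid_morphism ncq_pi.
Proof. by split=> // f g; exact: pi_ncqM. Qed.
HB.instance Definition _ := GRing.isZmodMorphism.Build S ncq ncq_pi
  ncq_pi_additive.
HB.instance Definition _ := GRing.isMonoidMorphism.Build S ncq ncq_pi
  ncq_pi_monoid.

Lemma ncq_piP f g : nc_closed_ideal G (f - g) <-> ncq_pi f = ncq_pi g.
Proof. by split=> [/in_closed_idealP/pi_ncqP | /pi_ncqP/in_closed_idealP]. Qed.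

End ClosedIdealQuotient.

(** * Inverting the identity minus a matrix of variables *)

Section PathSeries.
Variables (K : fieldType) (X : eqType) (n : nat) (x : 'I_n -> 'I_n -> X).
Local Notation S := (ncps K X).

(** The number, taken in [K], of walks from [i] to [j] whose step labels [x k l] spell [w]: the
    coefficient of [w] in the sum of all powers of the matrix of variables. *)
Fixpoint path_coef (w : seq X) (i j : 'I_n) : K :=
  if w is c :: w' then \sum_l (c == x i l)%:R * path_coef w' l j
  else (i == j)%:R.

(** Splitting off the first step of a walk gives [A *m P = P - 1%:M]. This holds for free variables,
    before any relation is imposed. *)
Lemma one_sub_vars_inverse :
  (1%:M - \matrix_(i, j) nc_var K (x i j)) *m
    \matrix_(i, j) NCPS (fun w => path_coef w i j) = 1%:M :> 'M[S]_n.
Proof.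
set A := \matrix_(i, j) nc_var _ _; set P := \matrix_(i, j) NCPS _.
suff AP : A *m P = P - 1%:M by rewrite mulmxBl mul1mx AP subKr.
apply/matrixP => i j; rewrite !mxE; apply: ncpsP => w.
rewrite coef_nc_sum coef_ncB.
have -> : ((i == j)%:R : S) w = ((w == [::]) && (i == j))%:R.
  by case: (i == j); rewrite ?coef_nc1 ?andbT ?andbF.
under eq_bigr => l _ do rewrite [A i l]mxE [P l j]mxE.
case: w => [|c w]; rewrite [RHS]/=.
  rewrite subrr big1 // => l _.
  by rewrite [LHS]nc_mul_nil /= mul0r.
rewrite subr0; apply: eq_bigr => l _.
rewrite [LHS]nc_mul_cons [nc_var _ _ [::]]/= mul0r add0r.
have -> : nc_shift c (nc_var K (x i l)) = nc_scalar X (c == x i l)%:R.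
  by apply: ncpsP => -[|d v] /=; rewrite eqseq_cons ?andbT ?andbF.
by rewrite [LHS]coef_nc_scalarM.
Qed.

End PathSeries.

(** * Column determinants under casts and ring morphisms *)

Lemma cdet_cast (R : pzRingType) n n' (e : n = n') (A : 'M[R]_n') :
  cdet (mxsub (cast_ord e) (cast_ord e) A) = cdet A.
Proof.
case: n' / e A => A; congr cdet.
by apply/matrixP => i j; rewrite mxE !cast_ord_id.
Qed.

Lemma cdet_map_mx (R S : pzRingType) (f : {rmorphism R -> S}) n (A : 'M[R]_n) :
  cdet (map_mx f A) = f (cdet A).
Proof. by rewrite !cdetE map_trmx det_map_mx. Qed.

(** This form separates the two inputs: the system [B *m X = U] is solved among series, while rows
    commute only after passing to the quotient. *)
Lemma rmorph_cdet_schur (R S : pzRingType) (f : {rmorphism R -> S}) n1 n2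
    (B : 'M[R]_n1) (U : 'M[R]_(n1, n2)) (V : 'M[R]_(n2, n1)) (D : 'M[R]_n2)
    (X : 'M[R]_(n1, n2)) :
    row_commuting (map_mx f (block_mx B U V D)) -> B *m X = U ->
  f (cdet (block_mx B U V D)) = f (cdet B) * f (cdet (D - V *m X)).
Proof.
rewrite -!cdet_map_mx map_block_mx map_mxB map_mxM => commM BX.
by apply: cdet_schur; rewrite // -map_mxM BX.
Qed.

Lemma cdet_mx11 (R : pzRingType) (A : 'M[R]_1) : cdet A = A ord0 ord0.
Proof.
rewrite cdet_sum (big_pred1 1%g) => [|s].
  by rewrite odd_perm1 mul1r big_ord1 perm1.
by apply/esym/eqP/permP => i; rewrite !ord1.
Qed.

(** * The Cartier-Foata case of the Sylvester identity *)

Section Sylvester.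
Variables (K : fieldType) (m n : nat) (le_nm : (n <= m)%N).
Local Notation A := (ncps K ('I_m * 'I_m)%type).
Local Notation pi := (@ncq_pi K _ (@cf_relations K m)).
Local Notation gen := (cf_gen K m).
Local Notation lo := (lo_idx le_nm).
Local Notation hi := (hi_idx le_nm).

Lemma lo_idx_inj : injective lo.
Proof. by move=> i j /(congr1 val) /= /val_inj. Qed.

Lemma hi_idx_inj : injective hi.
Proof. by move=> i j /cast_ord_inj/rshift_inj. Qed.

Lemma lo_neq_hi i j : lo i != hi j.
Proof. by rewrite -val_eqE /= ltn_eqF // (leq_trans (ltn_ord i)) ?leq_addr. Qed.

Lemma pi_gen_comm i j k l :
  i != j -> GRing.comm (pi (gen i k)) (pi (gen j l)).
Proof.
move=> neq_ij; rewrite /GRing.comm -!rmorphM; apply/ncq_piP.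
by apply: nc_closed_ideal_gen; exists i, j, k, l.
Qed.

(** The constants 0 and 1 are central, so only generators have to be exchanged, and injectivity of
    [rho] puts them in different rows. The criterion serves both the full matrix and the bordered
    ones. *)
Lemma row_commuting_pi p q (M : 'M[A]_(p, q)) (rho : 'I_p -> 'I_m) :
    injective rho ->
    (forall r c, exists (b : bool) k, M r c = b%:R - gen (rho r) k) ->
  row_commuting (map_mx pi M).
Proof.
move=> inj_rho entryM r s c d neq_rs; rewrite !mxE.
have [b [k ->]] := entryM r c; have [b' [l ->]] := entryM s d.
rewrite !rmorphB !rmorph_nat.
apply: commrB; first exact/commr_nat.
apply/commr_sym/commrB; first exact/commr_nat.
by apply/pi_gen_comm; rewrite eq_sym (inj_eq inj_rho).
Qed.

Lemma one_sub_gen_block :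
  mxsub (cast_ord (subnKC le_nm)) (cast_ord (subnKC le_nm)) (1%:M - gen) =
  block_mx (1%:M - cf_gen0 K le_nm) (- mxsub lo hi gen)
           (- mxsub hi lo gen) (1%:M - mxsub hi hi gen).
Proof.
have loE i : cast_ord (subnKC le_nm) (lshift (m - n) i) = lo i.
  exact: val_inj.
have hiE i : cast_ord (subnKC le_nm) (rshift n i) = hi i by [].
apply/matrixP => i j; rewrite [LHS]mxE -(splitK i) -(splitK j).
case: (split i) => k; case: (split j) => l; rewrite /= ?loE ?hiE.
- by rewrite block_mxEul !mxE (inj_eq lo_idx_inj).
- by rewrite block_mxEur !mxE (negPf (lo_neq_hi _ _)) sub0r.
- by rewrite block_mxEdl !mxE eq_sym (negPf (lo_neq_hi _ _)) sub0r.
- by rewrite block_mxEdr !mxE (inj_eq hi_idx_inj).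
Qed.

Lemma row_commuting_gen_block :
  row_commuting (map_mx pi
    (block_mx (1%:M - cf_gen0 K le_nm) (- mxsub lo hi gen)
       (- mxsub hi lo gen) (1%:M - mxsub hi hi gen))).
Proof.
rewrite -one_sub_gen_block.
apply: (row_commuting_pi (rho := cast_ord (subnKC le_nm))) => [|r c].
  exact: cast_ord_inj.
exists (r == c), (cast_ord (subnKC le_nm) c).
rewrite mxE [LHS]mxE [X in X + _]mxE [X in _ + X]mxE.
by rewrite (inj_eq (@cast_ord_inj _ _ _)).
Qed.

Lemma row_commuting_bordered i j :
  row_commuting (map_mx pi (cf_bordered K le_nm (hi i) j)).
Proof.
pose rho (r : 'I_(n + 1)) := if split r is inl k then lo k else hi i.
apply: (row_commuting_pi (rho := rho)).
  move=> r s; rewrite /rho -{2}(splitK r) -{2}(splitK s).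
  case: (split r) => k; case: (split s) => l /=.
  - by move/lo_idx_inj->.
  - by move/eqP; rewrite (negPf (lo_neq_hi _ _)).
  - by move/esym/eqP; rewrite (negPf (lo_neq_hi _ _)).
  - by rewrite !ord1.
move=> r c; rewrite /rho -{1}(splitK r) -(splitK c) /cf_bordered.
case: (split r) => k; case: (split c) => l /=.
- by exists (k == l), (lo l); rewrite block_mxEul !mxE.
- by exists false, j; rewrite block_mxEur !mxE sub0r.
- by exists false, (lo l); rewrite block_mxEdl !mxE sub0r.
(* The corner carries no identity term, hence [false] although the entry is diagonal. *)
- by exists false, j; rewrite block_mxEdr !mxE !ord1 eqxx sub0r.
Qed.

Lemma cf_sylvester :
  cf_eq ((cdet (1%:M - cf_gen0 K le_nm))^-1 * cdet (1%:M - gen))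
        (cdet (1%:M - cf_C K le_nm)).
Proof.
apply/ncq_piP.
pose B := 1%:M - cf_gen0 K le_nm.
pose G : 'M[A]_n := \matrix_(i, j)
  NCPS (fun w => path_coef K (fun k l => (lo k, lo l)) w i j).
have BG : B *m G = 1%:M.
  rewrite -[RHS](one_sub_vars_inverse K (fun k l => (lo k, lo l))).
  by congr ((_ - _) *m _); apply/matrixP => i j; rewrite !mxE.
pose X := G *m - mxsub lo hi gen.
have BX : B *m X = - mxsub lo hi gen by rewrite mulmxA BG mul1mx.
have dB : pi (cdet B)^-1 * pi (cdet B) = 1.
  by rewrite -rmorphM mulVr ?rmorph1 // cdet_gen0_unit.
have cancel_dB x : pi (cdet B)^-1 * (pi (cdet B) * x) = x.
  by rewrite mulrA dB mul1r.
rewrite rmorphM /= -(cdet_cast (subnKC le_nm)) one_sub_gen_block.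
rewrite (rmorph_cdet_schur row_commuting_gen_block BX) cancel_dB.
rewrite -!cdet_map_mx; congr cdet; apply/matrixP => i j.
rewrite [LHS]mxE [RHS]mxE.
(* Column [j] of the same solution [X] solves the system of the bordered matrix. *)
have BXj : B *m col j X = - \col_k gen (lo k) (hi j).
  by rewrite colE mulmxA -colE BX; apply/matrixP => k l; rewrite !mxE.
have := rmorph_cdet_schur (@row_commuting_bordered i (hi j)) BXj.
move/(congr1 (fun x => pi (cdet B)^-1 * x)); rewrite cancel_dB => e.
(* The corner of the bordered matrix is that of [I - A] without its identity part, so its 1 x 1
   Schur complement differs from the entry of [D - V X] exactly by [(i == j)%:R]. *)
transitivity (pi ((i == j)%:R +
   cdet (- (gen (hi i) (hi j))%:M - (- \row_k gen (hi i) (lo k)) *m col j X))).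
  congr (pi _); rewrite cdet_mx11 !mxE eqxx mulr1n addrA.
  by congr (_ - _); apply: eq_bigr => k _; rewrite !mxE.
rewrite rmorphD -e -rmorphM -rmorphD /=; congr (pi _).
by rewrite -/(cf_bordered K le_nm (hi i) (hi j)) !mxE mulNr opprK.
Qed.

End Sylvester.

Theorem theorem5p4 (R : realType) (m n : nat) (n_ge1 : (1 <= n)%N)
    (lt_nm : (n < m)%N) :
  cf_eq ((cdet (1%:M - cf_gen0 (R[i]) (ltnW lt_nm)))^-1
           * cdet (1%:M - cf_gen (R[i]) m))
        (cdet (1%:M - cf_C (R[i]) (ltnW lt_nm))).
Proof. exact: cf_sylvester. Qed.
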